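(* Assume there exists a Souslin line (i.e., assume the negation of Souslin's Hypothesis). Then there are Rothberger spaces $X$ and $Y$ such that $X\times Y$ is not weakly Lindel\''of.
   Context: All spaces are infinite ${\sf T}_1$ topological spaces. A Souslin line is a complete dense linearly ordered set $L$ which, in its order topology, is not separable but in which every family of pairwise disjoint open intervals is countable. For families $\mathcal{A},\mathcal{B}$, ${\sf S}_1(\mathcal{A},\mathcal{B})$ means: for each sequence $(A_n:n\in\mathbb{N})$ of elements of $\mathcal{A}$ there are $B_n\in A_n$ ($n\in\mathbb{N}$) with $\{B_n:n\in\mathbb{N}\}\in\mathcal{B}$. A space is Rothberger if it satisfies ${\sf S}_1(\mathcal{O},\mathcal{O})$, where $\mathcal{O}$ is the collection of open covers of the space. A space is weakly Lindel\''of if every open cover has a countable subfamily whose union is dense in the space. *)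

(* Defs.v *)
From Stdlib Require Import List Classical.

Set Implicit Arguments.

Section Order.
Variable L : Type.
Variable lt : L -> L -> Prop.

Definition strict_linear_order : Prop :=
  (forall x, ~ lt x x) /\
  (forall x y z, lt x y -> lt y z -> lt x z) /\
  (forall x y, lt x y \/ x = y \/ lt y x).

Definition order_complete : Prop :=
  forall A : L -> Prop,
    (exists a, A a) ->
    (exists b, forall a, A a -> ~ lt b a) ->
    exists s, (forall a, A a -> ~ lt s a) /\
              (forall b, (forall a, A a -> ~ lt b a) -> ~ lt b s).

Definition order_dense : Prop :=
  forall x y, lt x y -> exists z, lt x z /\ lt z y.

Definition ival (lo hi : option L) (y : L) : Prop :=
  match lo with Some a => lt a y | None => True end /\
  match hi with Some b => lt y b | None => True end.

Definition order_open (U : L -> Prop) : Prop :=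
  forall x, U x -> exists lo hi : option L,
    ival lo hi x /\ forall y, ival lo hi y -> U y.

Definition countable_subset (D : L -> Prop) : Prop :=
  exists f : L -> nat, forall x y, D x -> D y -> f x = f y -> x = y.

Definition order_separable : Prop :=
  exists D : L -> Prop, countable_subset D /\
    forall U, order_open U -> (exists x, U x) -> exists x, D x /\ U x.

Definition open_interval (a b : L) (y : L) : Prop := lt a y /\ lt y b.

Definition order_ccc : Prop :=
  forall (I : Type) (a b : I -> L),
    (forall i, lt (a i) (b i)) ->
    (forall i j, i <> j -> forall y, ~ (open_interval (a i) (b i) y /\ open_interval (a j) (b j) y)) ->
    exists f : I -> nat, forall i j, f i = f j -> i = j.

Definition souslin_line : Prop :=
  strict_linear_order /\ order_complete /\ order_dense /\
  ~ order_separable /\ order_ccc.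

End Order.

Section Topology.
Variable X : Type.
Variable open : (X -> Prop) -> Prop.

Definition is_topology : Prop :=
  open (fun _ => True) /\
  (forall U V, open U -> open V -> open (fun x => U x /\ V x)) /\
  (forall F : (X -> Prop) -> Prop, (forall U, F U -> open U) ->
     open (fun x => exists U, F U /\ U x)).

Definition infinite_type : Prop := forall l : list X, exists x, ~ In x l.

Definition T1 : Prop :=
  forall x y, x <> y -> exists U, open U /\ U x /\ ~ U y.

Definition open_cover (C : (X -> Prop) -> Prop) : Prop :=
  (forall U, C U -> open U) /\ (forall x, exists U, C U /\ U x).

Definition rothberger : Prop :=
  forall C : nat -> (X -> Prop) -> Prop,
    (forall n, open_cover (C n)) ->
    exists B : nat -> X -> Prop, (forall n, C n (B n)) /\ (forall x, exists n, B n x).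

Definition dense_set (D : X -> Prop) : Prop :=
  forall U, open U -> (exists x, U x) -> exists x, U x /\ D x.

Definition weakly_lindelof : Prop :=
  forall C, open_cover C ->
    exists f : nat -> X -> Prop, (forall n, C (f n)) /\
      dense_set (fun x => exists n, f n x).

End Topology.

Definition prod_open (X Y : Type) (oX : (X -> Prop) -> Prop) (oY : (Y -> Prop) -> Prop)
  (W : X * Y -> Prop) : Prop :=
  forall p, W p -> exists U V, oX U /\ oY V /\ U (fst p) /\ V (snd p) /\
     (forall x y, U x -> V y -> W (x, y)).

(* Main.v *)
(** The Souslin line [L] yields a Souslin tree [T] of open intervals, ordered by reverse
    inclusion, in which every interval [K] comes with an increasing sequence of points that
    is avoided by all members of [T] inside [K] and cuts [K] into parts, each containing
    members of [T].  Both spaces have [T] as underlying set: a neighbourhood of [K] contains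
    all nodes lying in all but finitely many of the even (for [X]), resp. odd (for [Y]),
    parts of [K].

    Rothberger: given covers [C n], the nodes [t] such that, for every [n], some member of
    [C n] contains the cone above [t] form an upward closed set; it has countable complement
    because antichains and sets of predecessors are countable.  Its minimal elements are
    countably many, and it suffices to cover their cones and the countable complement.

    Product: sending [(x, y)] to the set of common predecessors of [x] and [y] is locally
    constant on [X * Y] (at [(s, s)] because even and odd parts are disjoint), and takes
    uncountably many values.  Hence [X * Y] is partitioned into uncountably many nonempty
    open sets. *)

From Stdlib Require Import List Classical ClassicalEpsilon FunctionalExtensionality
  ProofIrrelevance Arith Lia Cantor.
From mathcomp Require boolp wochoice.
Require Import Defs.

Set Implicit Arguments.

Lemma countable_sub (L : Type) (D E : L -> Prop) :
  (forall x, D x -> E x) -> countable_subset E -> countable_subset D.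
Proof. intros H [f Hf]; exists f; auto. Qed.

Lemma countable_inj (J L : Type) (g : J -> L) (D : J -> Prop) (E : L -> Prop) :
  (forall x y, g x = g y -> x = y) -> (forall x, D x -> E (g x)) ->
  countable_subset E -> countable_subset D.
Proof. intros inj H [f Hf]; exists (fun x => f (g x)); auto. Qed.

Lemma countable_range (L : Type) (f : nat -> L) :
  countable_subset (fun x => exists n, f n = x).
Proof.
exists (fun x => epsilon (inhabits 0) (fun n => f n = x)).
intros x y Hx Hy Hxy.
rewrite <- (epsilon_spec (inhabits 0) _ Hx), <- (epsilon_spec (inhabits 0) _ Hy).
now rewrite Hxy.
Qed.

Lemma countable_bigcup (J L : Type) (E : J -> Prop) (F : J -> L -> Prop) :
  countable_subset E -> (forall i, E i -> countable_subset (F i)) ->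
  countable_subset (fun x => exists i, E i /\ F i x).
Proof.
intros [f Hf] HF.
destruct (classic (inhabited J)) as [inJ|noJ].
2:{ exists (fun _ => 0); intros x y [i _]; elim noJ; now constructor. }
set (idx x := epsilon inJ (fun i => E i /\ F i x)).
assert (cF : exists g : J -> L -> nat, forall i, E i ->
    forall x y, F i x -> F i y -> g i x = g i y -> x = y).
{ exists (fun i => epsilon (inhabits (fun _ => 0))
    (fun h => forall x y, F i x -> F i y -> h x = h y -> x = y)).
  intros i Hi; apply (epsilon_spec _ _ (HF i Hi)). }
destruct cF as [g Hg].
exists (fun x => to_nat (f (idx x), g (idx x) x)).
intros x y Hx Hy Hxy.
destruct (epsilon_spec inJ _ Hx) as [Ex Fx], (epsilon_spec inJ _ Hy) as [Ey Fy].
fold (idx x) in Ex, Fx; fold (idx y) in Ey, Fy.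
apply to_nat_inj in Hxy; injection Hxy as Hi Hxy.
apply Hf in Hi; trivial.
rewrite <- Hi in *; eapply Hg; eauto.
Qed.

Lemma countable_bigcup_nat (L : Type) (F : nat -> L -> Prop) :
  (forall n, countable_subset (F n)) -> countable_subset (fun x => exists n, F n x).
Proof.
intros H; apply (@countable_sub _ _ (fun x => exists n, True /\ F n x)).
- intros x [n Hn]; eauto.
- apply countable_bigcup; [exists (fun n => n)|]; auto.
Qed.

Lemma countable_union (L : Type) (D E : L -> Prop) :
  countable_subset D -> countable_subset E -> countable_subset (fun x => D x \/ E x).
Proof.
intros HD HE.
apply (@countable_sub _ _ (fun x => exists n, match n with 0 => D x | _ => E x end)).
- intros x [Hx|Hx]; [now exists 0|now exists 1].
- apply countable_bigcup_nat; now intros [|n].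
Qed.

Lemma countable_In (L : Type) (l : list L) : countable_subset (fun x => In x l).
Proof.
induction l as [|a l IH]; [now exists (fun _ => 0)|].
apply countable_union; [exists (fun _ => 0); congruence|exact IH].
Qed.

Lemma well_founded_min (I : Type) (R : I -> I -> Prop) (P : I -> Prop) :
  well_founded R -> (exists x, P x) -> exists x, P x /\ forall y, P y -> ~ R y x.
Proof.
intros wf [x Px]; apply NNPP; intros H; revert Px.
induction (wf x) as [x _ IH]; intros Px.
apply H; exists x; split; trivial; intros y Py Ryx; exact (IH y Ryx Py).
Qed.

Lemma well_ordering (I : Type) :
  exists R : I -> I -> Prop, well_founded R /\ forall x y, R x y \/ x = y \/ R y x.
Proof.
destruct (wochoice.well_ordering_principle
  (boolp.boolp_classicType__canonical__eqtype_Equality I)) as [le wo].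
assert (min : forall P : I -> Prop, (exists x, P x) -> exists z,
  P z /\ (forall x, P x -> le z x = true) /\
  forall y, P y -> (forall x, P x -> le y x = true) -> y = z).
{ intros P [x Px].
  destruct (wo (fun x => boolp.asbool (P x))) as [z [[Pz Hz] uz]].
  - exists x; exact (boolp.asboolT Px).
  - exists z; split; [exact (boolp.asboolW Pz)|split].
    + intros y Py; exact (Hz y (boolp.asboolT Py)).
    + intros y Py Hy; symmetry; apply uz; split; [exact (boolp.asboolT Py)|].
      intros t Pt; exact (Hy t (boolp.asboolW Pt)). }
exists (fun x y => le y x <> true); split.
- intros x; apply NNPP; intros nx.
  destruct (min (fun z => ~ Acc (fun x y => le y x <> true) z)) as [z [nz [Hz _]]]; eauto.
  apply nz; constructor; intros y yz; apply NNPP; intros ny; auto.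
- intros x y.
  assert (refl : forall z, le z z = true).
  { intros z; destruct (min (eq z)) as [t [<- [H _]]]; eauto. }
  destruct (classic (le y x = true)) as [yx|]; [|now left].
  destruct (classic (le x y = true)) as [xy|]; [|now right; right].
  right; left.
  destruct (min (fun z => z = x \/ z = y)) as [z [_ [_ uz]]]; [eauto|].
  transitivity z; [|symmetry]; apply uz; auto; intros t [->| ->]; auto.
Qed.

Lemma greedy_selection (I : Type) (R : I -> I -> Prop) (good : I -> Prop)
    (compat : I -> I -> Prop) :
  well_founded R ->
  exists T : I -> Prop,
    forall J, T J <-> good J /\ forall K, R K J -> T K -> compat K J.
Proof.
intros wf.
set (F := fun J (f : forall K, R K J -> Prop) =>
  good J /\ forall K (h : R K J), f K h -> compat K J).
exists (Fix wf (fun _ => Prop) F); intros J.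
rewrite Fix_eq; [reflexivity|].
intros x f g H; replace g with f; trivial.
extensionality y; extensionality p; apply H.
Qed.

(* [part s i x]: the node [x] lies strictly above [s], in the [i]-th of the countably many
   pieces into which [s] splits; nodes above [s] may also lie in no piece. *)
Record fan_tree (T : Type) (le : T -> T -> Prop) (part : T -> nat -> T -> Prop) : Prop := {
  ft_refl : forall x, le x x;
  ft_trans : forall x y z, le x y -> le y z -> le x z;
  ft_antisym : forall x y, le x y -> le y x -> x = y;
  ft_tree : forall r s x, le r x -> le s x -> le r s \/ le s r;
  ft_min : forall P : T -> Prop, (exists x, P x) ->
    exists x, P x /\ forall y, P y -> le y x -> y = x;
  ft_part_le : forall s i x, part s i x -> le s x;
  ft_part_neq : forall s i, ~ part s i s;
  ft_part_up : forall s i x y, part s i x -> le x y -> part s i y;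
  ft_part_inj : forall s i j x, part s i x -> part s j x -> i = j;
  ft_part_down : forall s r i x, le s r -> r <> s -> le r x -> part s i x -> part s i r;
  ft_part_ex : forall s i, exists x, part s i x;
  ft_antichain : forall A : T -> Prop,
    (forall x y, A x -> A y -> le x y -> x = y) -> countable_subset A;
  ft_pred : forall x, countable_subset (fun r => le r x);
  ft_uncountable : ~ countable_subset (fun _ : T => True) }.

Section FanTree.
Variables (T : Type) (le : T -> T -> Prop) (part : T -> nat -> T -> Prop).
Hypothesis ft : fan_tree le part.

Definition fan_open (P : nat -> Prop) (U : T -> Prop) : Prop :=
  forall t, U t -> exists n, forall i x, n <= i -> P i -> part t i x -> U x.

Definition fan_nbhd (P : nat -> Prop) (t : T) (n : nat) (x : T) : Prop :=
  x = t \/ exists i, n <= i /\ P i /\ part t i x.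

Lemma fan_topology (P : nat -> Prop) : is_topology (fan_open P).
Proof.
split; [|split].
- intros t _; exists 0; auto.
- intros U V HU HV t [Ut Vt].
  destruct (HU t Ut) as [n Hn], (HV t Vt) as [m Hm].
  exists (n + m); intros i x Hi Pi Hx; split; [apply (Hn i)|apply (Hm i)]; auto; lia.
- intros F HF t [U [FU Ut]].
  destruct (HF U FU t Ut) as [n Hn]; exists n; eauto.
Qed.

Lemma fan_open_up (P : nat -> Prop) (U : T -> Prop) :
  (forall x y, U x -> le x y -> U y) -> fan_open P U.
Proof.
intros up t Ut; exists 0; intros i x _ _ Hx.
apply (up t); trivial; eapply ft_part_le; eauto.
Qed.

Lemma fan_open_cone (P : nat -> Prop) (s : T) : fan_open P (le s).
Proof. apply fan_open_up; intros x y; apply (ft_trans ft). Qed.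

Lemma fan_open_nbhd (P : nat -> Prop) (t : T) (n : nat) : fan_open P (fan_nbhd P t n).
Proof.
intros x [->|[i [Hi [Pi Hx]]]].
- exists n; intros i x Hi Pi Hx; right; eauto.
- exists 0; intros j y _ _ Hy; right; exists i; repeat split; trivial.
  apply (ft_part_up ft) with x; trivial; eapply ft_part_le; eauto.
Qed.

Lemma fan_nbhd_avoid (s t : T) :
  exists n, forall i, n <= i -> ~ part s i t.
Proof.
destruct (classic (exists i, part s i t)) as [[i Hi]|H].
- exists (S i); intros j Hj Hp.
  rewrite (ft_part_inj ft _ _ _ _ Hi Hp) in Hj; lia.
- exists 0; intros i _ Hi; eauto.
Qed.

Lemma fan_T1 (P : nat -> Prop) : T1 (fan_open P).
Proof.
intros s t Hst; destruct (fan_nbhd_avoid s t) as [n Hn].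
exists (fan_nbhd P s n); split; [apply fan_open_nbhd|split; [now left|]].
intros [E|[i [Hi [_ Hp]]]]; [congruence|exact (Hn i Hi Hp)].
Qed.

Lemma fan_infinite : infinite_type T.
Proof.
intros l; apply NNPP; intros H; apply (ft_uncountable ft).
apply (@countable_sub _ _ (fun x => In x l)); [|apply countable_In].
intros x _; apply NNPP; intros Hx; eauto.
Qed.

Lemma fan_minimal_below (D : T -> Prop) (x : T) : D x ->
  exists a, le a x /\ D a /\ forall y, D y -> le y a -> y = a.
Proof.
intros Dx; destruct (ft_min ft (fun a => le a x /\ D a)) as [a [[ax Da] Ha]].
- exists x; split; trivial; apply (ft_refl ft).
- exists a; repeat split; trivial; intros y Dy ya.
  apply Ha; trivial; split; trivial; eapply ft_trans; eauto.
Qed.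

Lemma countable_minimal (D : T -> Prop) :
  countable_subset (fun a => D a /\ forall y, D y -> le y a -> y = a).
Proof. apply (ft_antichain ft); intros x y [Dx _] [_ Hy] Hxy; auto. Qed.

Lemma countable_compl_dense_up (D : T -> Prop) :
  (forall x y, D x -> le x y -> D y) -> (forall x, exists y, le x y /\ D y) ->
  countable_subset (fun x => ~ D x).
Proof.
intros up dense.
apply (@countable_sub _ _ (fun x => exists a,
  (D a /\ forall y, D y -> le y a -> y = a) /\ le x a)).
- intros x nDx; destruct (dense x) as [y [xy Dy]].
  destruct (fan_minimal_below D y Dy) as [a [ay [Da Ha]]].
  exists a; split; [now split|].
  destruct (ft_tree ft _ _ _ xy ay) as [h|h]; trivial.
  elim nDx; eauto.
- apply countable_bigcup; [apply countable_minimal|intros; apply (ft_pred ft)].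
Qed.

Lemma fan_rothberger (P : nat -> Prop) :
  (forall n, exists i, n <= i /\ P i) -> rothberger (fan_open P).
Proof.
intros HP C HC.
set (D n t := exists U, C n U /\ forall x, le t x -> U x).
assert (cD : forall n, countable_subset (fun t => ~ D n t)).
{ intros n; apply countable_compl_dense_up.
  - intros x y [U [CU HU]] xy; exists U; split; trivial.
    intros z yz; apply HU; eapply ft_trans; eauto.
  - intros t; destruct (HC n) as [op cov]; destruct (cov t) as [U [CU Ut]].
    destruct (op U CU t Ut) as [m Hm]; destruct (HP m) as [i [mi Pi]].
    destruct (ft_part_ex ft t i) as [x Hx].
    exists x; split; [eapply ft_part_le; eauto|].
    exists U; split; trivial; intros z xz; apply (Hm i); trivial.
    eapply ft_part_up; eauto. }
set (DD t := forall n, D n t).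
set (A a := DD a /\ forall y, DD y -> le y a -> y = a).
assert (cS : countable_subset (fun t => A t \/ ~ DD t)).
{ apply countable_union; [apply countable_minimal|].
  apply (@countable_sub _ _ (fun t => exists n, ~ D n t)).
  - intros t Ht; now apply not_all_ex_not.
  - now apply countable_bigcup_nat. }
destruct cS as [h Hh].
assert (pick : forall n, exists U, C n U /\ forall t, A t \/ ~ DD t -> h t = n ->
    U t /\ (DD t -> forall x, le t x -> U x)).
{ intros n; destruct (classic (exists t, (A t \/ ~ DD t) /\ h t = n)) as [[t [St ht]]|none].
  - assert (exists U, C n U /\ U t /\ (DD t -> forall x, le t x -> U x)) as [U [CU HU]].
    { destruct (classic (DD t)) as [Dt|nDt].
      - destruct (Dt n) as [U [CU HU]]; exists U; repeat split; auto.
        apply HU, (ft_refl ft).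
      - destruct (proj2 (HC n) t) as [U [CU Ut]]; exists U; repeat split; tauto. }
    exists U; split; trivial; intros s Ss hs.
    replace s with t; trivial; apply Hh; congruence.
  - assert (exists U, C n U) as [U CU].
    { assert (inhabited T) as [t].
      { apply NNPP; intros H; apply (ft_uncountable ft); exists (fun _ => 0).
        intros x; elim H; now constructor. }
      destruct (proj2 (HC n) t) as [U [CU _]]; eauto. }
    exists U; split; trivial; intros t St ht; elim none; eauto. }
apply choice in pick; destruct pick as [B HB].
exists B; split; [apply HB|intros x].
destruct (classic (DD x)) as [Dx|nDx].
- destruct (fan_minimal_below DD x Dx) as [a [ax Aa]].
  exists (h a); destruct (HB (h a)) as [_ H].
  apply (H a); [now left|reflexivity|apply Aa|trivial].
- exists (h x); apply HB; auto.
Qed.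

Lemma clb_branch (s x y : T) :
  le s y -> (x = s \/ exists i, part s i x /\ ~ part s i y) ->
  forall r, le r x /\ le r y <-> le r s.
Proof.
intros sy Hx r.
assert (sx : le s x).
{ destruct Hx as [->|[i [Hi _]]]; [apply (ft_refl ft)|eapply ft_part_le; eauto]. }
split.
- intros [rx ry]; destruct Hx as [->|[i [Hi nHi]]]; trivial.
  destruct (ft_tree ft _ _ _ rx sx) as [h|h]; trivial.
  destruct (classic (r = s)) as [->|rs]; [apply (ft_refl ft)|].
  elim nHi; apply (ft_part_up ft) with r; trivial.
  apply (ft_part_down ft) with x; trivial.
- intros rs; split; eapply ft_trans; eauto.
Qed.

Lemma clb_nbhd_below (P : nat -> Prop) (s t : T) : le s t -> s <> t ->
  exists U, fan_open P U /\ U s /\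
    forall x y, U x -> le t y -> forall r, le r x /\ le r y <-> le r s.
Proof.
intros st ne; destruct (fan_nbhd_avoid s t) as [n Hn].
exists (fan_nbhd P s n); split; [apply fan_open_nbhd|split; [now left|]].
intros x y Ux ty; apply clb_branch; [eapply ft_trans; eauto|].
destruct Ux as [->|[i [ni [_ Hi]]]]; [now left|].
right; exists i; split; trivial; intros Hy.
apply (Hn i ni), (ft_part_down ft) with y; auto.
Qed.

(* On the diagonal, [x] and [y] end up in different parts of [s] because [P] and [Q] are
   disjoint. *)
Lemma clb_nbhd (P Q : nat -> Prop) (s t : T) : (forall i, P i -> ~ Q i) ->
  exists U V, fan_open P U /\ fan_open Q V /\ U s /\ V t /\
    forall x y, U x -> V y -> forall r, le r x /\ le r y <-> le r s /\ le r t.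
Proof.
intros PQ.
destruct (classic (s = t)) as [<-|ne].
{ exists (fan_nbhd P s 0), (fan_nbhd Q s 0).
  split; [apply fan_open_nbhd|split; [apply fan_open_nbhd|]].
  split; [now left|split; [now left|]]; intros x y Ux Vy r.
  cut (le r x /\ le r y <-> le r s); [tauto|].
  apply clb_branch.
  - destruct Vy as [->|[i [_ [_ Hi]]]]; [apply (ft_refl ft)|eapply ft_part_le; eauto].
  - destruct Ux as [->|[i [_ [Pi Hi]]]]; [now left|right].
    exists i; split; trivial; destruct Vy as [->|[j [_ [Qj Hj]]]].
    + apply (ft_part_neq ft).
    + intros Hy; apply (PQ i Pi); now rewrite (ft_part_inj ft _ _ _ _ Hy Hj). }
destruct (classic (le s t)) as [st|nst].
{ destruct (clb_nbhd_below P st ne) as [U [oU [Us HU]]].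
  exists U, (le t); repeat (split; [solve [trivial; apply fan_open_cone|apply (ft_refl ft)]|]).
  intros x y Ux ty r; rewrite (HU x y Ux ty r).
  split; [intros rs; split|]; try tauto; eapply ft_trans; eauto. }
destruct (classic (le t s)) as [ts|nts].
{ destruct (clb_nbhd_below Q ts (not_eq_sym ne)) as [V [oV [Vt HV]]].
  exists (le s), V; repeat (split; [solve [trivial; apply fan_open_cone|apply (ft_refl ft)]|]).
  intros x y sx Vy r; pose proof (HV y x Vy sx r) as Hr.
  assert (le r t -> le r s) by (intros; eapply ft_trans; eauto); tauto. }
exists (le s), (le t); repeat split; try apply fan_open_cone; try apply (ft_refl ft).
- destruct (ft_tree ft r s x) as [h|h]; trivial; try tauto.
  destruct (ft_tree ft s t y); try tauto; eapply ft_trans; eauto; tauto.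
- destruct (ft_tree ft r t y) as [h|h]; trivial; try tauto.
  destruct (ft_tree ft s t x); try tauto; eapply ft_trans; eauto; tauto.
- eapply ft_trans; eauto; tauto.
- eapply ft_trans; eauto; tauto.
Qed.

Lemma fan_prod_not_weakly_lindelof (P Q : nat -> Prop) : (forall i, P i -> ~ Q i) ->
  ~ weakly_lindelof (prod_open (fan_open P) (fan_open Q)).
Proof.
intros PQ wl.
set (O (q p : T * T) := forall r, le r (fst p) /\ le r (snd p) <-> le r (fst q) /\ le r (snd q)).
assert (oO : forall q, prod_open (fan_open P) (fan_open Q) (O q)).
{ intros q p Hp; destruct (clb_nbhd P Q (fst p) (snd p) PQ) as [U [V [oU [oV [Us [Vt H]]]]]].
  exists U, V; do 4 (split; [trivial|]); intros x y Ux Vy r; simpl.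
  rewrite (H x y Ux Vy r); apply Hp. }
destruct (wl (fun W => exists q, W = O q)) as [f [Cf df]].
{ split; [intros U [q ->]; apply oO|].
  intros p; exists (O p); split; [eauto|intros r; tauto]. }
apply (ft_uncountable ft).
assert (cov : forall s, exists n, f n (s, s)).
{ intros s; destruct (df (O (s, s)) (oO _)) as [p [Op [n fp]]].
  - exists (s, s); intros r; tauto.
  - exists n; destruct (Cf n) as [q Eq]; rewrite Eq in *.
    intros r; rewrite <- (fp r), (Op r); tauto. }
apply choice in cov; destruct cov as [g Hg].
exists g; intros x y _ _ E.
pose proof (Hg x) as Hx; pose proof (Hg y) as Hy; rewrite E in Hx.
destruct (Cf (g y)) as [q Eq]; rewrite Eq in Hx, Hy.
apply (ft_antisym ft).
- apply (Hy x), (Hx x); split; apply (ft_refl ft).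
- apply (Hx y), (Hy y); split; apply (ft_refl ft).
Qed.

End FanTree.

Section Line.
Variables (L : Type) (lt : L -> L -> Prop).
Hypothesis slo : strict_linear_order lt.
Hypothesis dense : order_dense lt.
Hypothesis ccc : order_ccc lt.

Lemma lt_irr x : ~ lt x x.
Proof. apply slo. Qed.

Lemma lt_tr x y z : lt x y -> lt y z -> lt x z.
Proof. apply slo. Qed.

Lemma lt_total x y : lt x y \/ x = y \/ lt y x.
Proof. apply slo. Qed.

Lemma lt_le_tr x y z : lt x y -> ~ lt z y -> lt x z.
Proof. destruct (lt_total y z) as [h|[->|h]]; try tauto; intros; eapply lt_tr; eauto. Qed.

Lemma le_lt_tr x y z : ~ lt y x -> lt y z -> lt x z.
Proof. destruct (lt_total x y) as [h|[->|h]]; try tauto; intros; eapply lt_tr; eauto. Qed.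

Ltac add H t := lazymatch goal with _ : t |- _ => fail | _ => assert (H : t) end.

Ltac order :=
  try (apply NNPP; intro);
  repeat match goal with
  | |- ~ _ => intro
  | H : _ /\ _ |- _ => destruct H
  | H : ~ ~ _ |- _ => apply NNPP in H
  | H : lt ?x ?x |- _ => elim (lt_irr H)
  | H : ?A, H' : ~ ?A |- _ => elim (H' H)
  | H : lt ?x ?y, H' : lt ?y ?z |- _ =>
      let N := fresh in add N (lt x z); [exact (lt_tr H H')|]
  | H : lt ?x ?y, H' : ~ lt ?z ?y |- _ =>
      let N := fresh in add N (lt x z); [exact (lt_le_tr H H')|]
  | H : ~ lt ?y ?x, H' : lt ?y ?z |- _ =>
      let N := fresh in add N (lt x z); [exact (le_lt_tr H H')|]
  end.

Lemma common_subinterval x y z w : lt x z -> lt y z -> lt x w -> lt y w ->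
  exists m n, lt m n /\ ~ lt m x /\ ~ lt m y /\ ~ lt z n /\ ~ lt w n.
Proof.
intros xz yz xw yw.
assert (exists m, ~ lt m x /\ ~ lt m y /\ lt m z /\ lt m w) as [m Hm].
{ destruct (classic (lt x y)); [exists y|exists x]; repeat split; trivial; order. }
assert (exists n, ~ lt z n /\ ~ lt w n /\ lt m n) as [n Hn].
{ destruct (classic (lt z w)); [exists z|exists w]; repeat split; try order. }
exists m, n; tauto.
Qed.

Lemma ccc_on (J : Type) (E : J -> Prop) (a b : J -> L) :
  (forall i, E i -> lt (a i) (b i)) ->
  (forall i j, E i -> E j -> i <> j -> ~ lt (a i) (b j) \/ ~ lt (a j) (b i)) ->
  countable_subset E.
Proof.
intros ab disj.
destruct (ccc (fun i : {i | E i} => a (proj1_sig i)) (fun i => b (proj1_sig i)))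
  as [f Hf].
- intros [i Ei]; simpl; auto.
- intros [i Ei] [j Ej] ne y [[h1 h2] [h3 h4]]; simpl in *.
  assert (ij : i <> j) by (intros ->; apply ne; f_equal; apply proof_irrelevance).
  destruct (disj i j Ei Ej ij); order.
- exists (fun i => epsilon (inhabits 0) (fun n => exists Ei, n = f (exist _ i Ei))).
  assert (g : forall x, E x -> exists Ei,
      epsilon (inhabits 0) (fun n => exists Ei, n = f (exist _ x Ei)) = f (exist _ x Ei)).
  { intros x Ex; apply (epsilon_spec (inhabits 0) (fun n => exists Ei, n = f (exist _ x Ei))).
    now exists (f (exist _ x Ex)), Ex. }
  intros x y Ex Ey; destruct (g x Ex) as [Ex' ->], (g y Ey) as [Ey' ->].
  intros Exy; apply Hf in Exy; now injection Exy.
Qed.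

Definition separable_on (p q : L) : Prop :=
  exists D, countable_subset D /\
    forall x y, ~ lt x p -> lt x y -> ~ lt q y -> exists d, D d /\ lt x d /\ lt d y.

Definition meets (K J : L * L) : Prop := lt (fst K) (snd J) /\ lt (fst J) (snd K).

Lemma order_separable_intro (D : L -> Prop) : countable_subset D ->
  (forall x y, lt x y -> exists d, D d /\ lt x d /\ lt d y) -> order_separable lt.
Proof.
intros cD HD.
destruct (classic (exists p q, lt p q)) as [[p [q pq]]|none].
- exists D; split; trivial; intros U oU [x Ux].
  destruct (oU x Ux) as [[lo|] [[hi|] [[Hlo Hhi] HU]]].
  + destruct (HD lo x Hlo) as [d [Dd [h1 h2]]]; exists d; split; trivial.
    apply HU; split; trivial; order.
  + destruct (HD lo x Hlo) as [d [Dd [h1 h2]]]; exists d; split; trivial.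
    apply HU; now split.
  + destruct (HD x hi Hhi) as [d [Dd [h1 h2]]]; exists d; split; trivial.
    apply HU; now split.
  + destruct (HD p q pq) as [d [Dd _]]; exists d; split; trivial.
    apply HU; now split.
- exists (fun _ => True); split; [|intros U _ [x Ux]; eauto].
  exists (fun _ => 0); intros x y _ _ _.
  destruct (lt_total x y) as [h|[h|h]]; trivial; elim none; eauto.
Qed.

Lemma nowhere_separable_interval : ~ order_separable lt ->
  exists u v, lt u v /\
    forall p q, ~ lt p u -> lt p q -> ~ lt v q -> ~ separable_on p q.
Proof.
intros nsep; apply NNPP; intros H; apply nsep.
assert (sub : forall u v, lt u v ->
    exists p q, ~ lt p u /\ lt p q /\ ~ lt v q /\ separable_on p q).
{ intros u v uv; apply NNPP; intros H'; apply H; exists u, v; split; trivial.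
  intros p q h1 h2 h3 h4; apply H'; exists p, q; auto. }
clear H.
destruct (well_ordering (L * L)) as [R [wf tot]].
destruct (greedy_selection (fun J => lt (fst J) (snd J) /\ separable_on (fst J) (snd J))
  (fun K J => ~ meets K J) wf) as [F HF].
assert (cF : countable_subset F).
{ apply (@ccc_on _ F fst snd).
  - intros J FJ; apply HF in FJ; apply FJ.
  - intros K J FK FJ ne; apply NNPP; intros H.
    assert (m : meets K J /\ meets J K) by (unfold meets; split; split; order; tauto).
    destruct (tot K J) as [h|[h|h]]; [|tauto|].
    + apply HF in FJ; apply (proj2 FJ K h FK), m.
    + apply HF in FK; apply (proj2 FK J h FJ), m. }
assert (cD : exists D : L * L -> L -> Prop, forall K, F K -> countable_subset (D K) /\
    forall x y, ~ lt x (fst K) -> lt x y -> ~ lt (snd K) y ->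
      exists d, D K d /\ lt x d /\ lt d y).
{ apply (choice (fun K DK => F K -> countable_subset DK /\
    forall x y, ~ lt x (fst K) -> lt x y -> ~ lt (snd K) y ->
      exists d, DK d /\ lt x d /\ lt d y)).
  intros K; destruct (classic (F K)) as [FK|nF].
  - destruct (proj1 (HF K) FK) as [[_ [DK HDK]] _]; eauto.
  - exists (fun _ => True); tauto. }
destruct cD as [D HD].
apply (@order_separable_intro (fun x => exists K, F K /\ D K x)).
- apply countable_bigcup; trivial; intros K FK; apply HD; trivial.
- intros x y xy.
  destruct (sub x y xy) as [p [q [xp [pq [qy spq]]]]].
  assert (exists K, F K /\ meets K (p, q)) as [K [FK [h1 h2]]].
  { destruct (classic (F (p, q))) as [h|nF]; [exists (p, q); split; trivial; now split|].
    apply NNPP; intros none; apply nF, HF; split; [now split|].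
    intros K _ FK m; apply none; eauto. }
  simpl in *.
  assert (Kl : lt (fst K) (snd K)) by (apply HF in FK; apply FK).
  destruct (@common_subinterval (fst K) p (snd K) q) as [m [n [mn [h3 [h4 [h5 h6]]]]]]; trivial.
  destruct (HD K FK) as [_ HK]; destruct (HK m n h3 mn h5) as [d [Dd [md dn]]].
  exists d; split; [eauto|split; order].
Qed.

Variables u v : L.
Hypothesis uv : lt u v.
Hypothesis nosep : forall p q, ~ lt p u -> lt p q -> ~ lt v q -> ~ separable_on p q.

Definition between (x y : L) : L := epsilon (inhabits x) (fun z => lt x z /\ lt z y).

Fixpoint mark (K : L * L) (i : nat) : L :=
  match i with 0 => fst K | S i => between (mark K i) (snd K) end.

Lemma between_spec x y : lt x y -> lt x (between x y) /\ lt (between x y) y.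
Proof. intros xy; apply (epsilon_spec _ _ (dense xy)). Qed.

Lemma mark_lt_snd K i : lt (fst K) (snd K) -> lt (mark K i) (snd K).
Proof. intros HK; induction i as [|i IH]; simpl; trivial; now apply between_spec. Qed.

Lemma mark_S K i : lt (fst K) (snd K) -> lt (mark K i) (mark K (S i)).
Proof. intros HK; apply between_spec, mark_lt_snd, HK. Qed.

Lemma mark_le K i j : lt (fst K) (snd K) -> i <= j -> ~ lt (mark K j) (mark K i).
Proof.
intros HK; induction 1 as [|j _ IH]; [apply lt_irr|].
pose proof (mark_S K j HK); order.
Qed.

Definition inside (K J : L * L) : Prop :=
  lt (fst K) (fst J) /\ lt (snd J) (snd K) /\
  forall i, ~ lt (fst J) (mark K i) \/ ~ lt (mark K i) (snd J).

Definition admissible (J : L * L) : Prop :=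
  lt (fst J) (snd J) /\ ~ lt (fst J) u /\ ~ lt v (snd J).

(* [node] is the greedy choice, along the well-order [R], of intervals each of which is
   disjoint from, or inside a part of, every earlier one; so inclusion between nodes refines
   [R] and is well-founded. *)
Variable R : L * L -> L * L -> Prop.
Hypothesis wfR : well_founded R.
Hypothesis totR : forall x y, R x y \/ x = y \/ R y x.
Variable node : L * L -> Prop.
Hypothesis nodeP : forall J,
  node J <-> admissible J /\ forall K, R K J -> node K -> ~ meets K J \/ inside K J.

Lemma node_lt J : node J -> lt (fst J) (snd J).
Proof. intros H; apply nodeP in H; apply H. Qed.

Lemma node_cmp J K : node J -> node K -> meets J K ->
  J = K \/ (inside J K /\ R J K) \/ (inside K J /\ R K J).
Proof.
intros nJ nK m.
destruct (totR J K) as [h|[h|h]]; auto.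
- apply nodeP in nK; destruct (proj2 nK J h nJ); tauto.
- apply nodeP in nJ; destruct (proj2 nJ K h nK) as [nm|]; [|tauto].
  elim nm; split; apply m.
Qed.

Lemma inside_trans J K M : lt (fst M) (snd M) -> inside J K -> inside K M -> inside J M.
Proof.
intros HM [h1 [h2 h3]] [h4 [h5 _]]; split; [order|split; [order|]].
intros i; destruct (h3 i); [left|right]; order.
Qed.

Lemma inside_meets J K : lt (fst J) (snd J) -> lt (fst K) (snd K) -> inside J K -> meets J K.
Proof. intros hJ hK [h1 [h2 _]]; split; order. Qed.

Lemma inside_R J K : node J -> node K -> inside J K -> R J K.
Proof.
intros nJ nK h.
destruct (node_cmp nJ nK (inside_meets (node_lt nJ) (node_lt nK) h)) as [<-|[h'|h']]; try tauto;
  destruct h; try destruct h' as [[]]; order.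
Qed.

Lemma countable_chain (C : L * L -> Prop) :
  (forall K, C K -> node K) -> (forall J K, C J -> C K -> meets J K) -> countable_subset C.
Proof.
intros Cn Cm.
(* In a decreasing chain of intervals the gaps between consecutive left ends are disjoint. *)
set (e K x := (exists J, C J /\ inside K J /\ x = fst J /\
    forall M, C M -> inside K M -> ~ R M J) \/
  ((forall J, C J -> ~ inside K J) /\ x = snd K)).
assert (He : exists f, forall K, e K (f K)).
{ apply choice; intros K; destruct (classic (exists J, C J /\ inside K J)) as [h|h].
  - destruct (well_founded_min _ wfR h) as [J [[CJ KJ] HJ]].
    exists (fst J); left; exists J; repeat split; trivial; try apply KJ.
    intros M CM KM; apply HJ; auto.
  - exists (snd K); right; split; trivial; intros J CJ KJ; eauto. }
destruct He as [f Hf].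
apply (@ccc_on _ C fst f).
- intros K CK; destruct (Hf K) as [[J [CJ [KJ [-> _]]]]|[_ ->]]; [apply KJ|].
  now apply node_lt, Cn.
- assert (aux : forall J K, C J -> C K -> inside J K -> ~ lt (fst K) (f J)).
  { intros J K CJ CK JK; destruct (Hf J) as [[M [CM [JM [-> HM]]]]|[none _]].
    - destruct (node_cmp (Cn K CK) (Cn M CM) (Cm K M CK CM)) as [->|[[_ h]|[[h _] _]]].
      + apply lt_irr.
      + elim (HM K CK JK h).
      + order.
    - elim (none K CK JK). }
  intros J K CJ CK ne.
  destruct (node_cmp (Cn J CJ) (Cn K CK) (Cm J K CJ CK)) as [E|[[h _]|[h _]]];
    [tauto|right|left]; auto.
Qed.

(* Were there no node inside [(p, q)], the nodes meeting it would form at most two chains,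
   so their ends and marks could not be dense in [(p, q)], and the greedy choice of nodes
   would have kept some interval that misses them. *)
Lemma node_dense p q : ~ lt p u -> lt p q -> ~ lt v q ->
  exists J, node J /\ lt p (fst J) /\ lt (snd J) q.
Proof.
intros hp pq hq; apply NNPP; intros none.
apply (nosep hp pq hq).
set (across K := node K /\ meets K (p, q) /\ (~ lt p (fst K) \/ ~ lt (snd K) q)).
assert (cacross : countable_subset across).
{ apply (@countable_sub _ _ (fun K =>
    (node K /\ meets K (p, q) /\ ~ lt p (fst K)) \/
    (node K /\ meets K (p, q) /\ ~ lt (snd K) q))).
  { unfold across; intros K; tauto. }
  apply countable_union; apply countable_chain; try tauto;
    intros J K [nJ [[h1 h2] h3]] [nK [[h4 h5] h6]]; simpl in *; split; order. }
exists (fun x => exists K, across K /\ exists n, mark K n = x \/ snd K = x).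
split.
{ apply countable_bigcup; trivial; intros K _.
  apply (@countable_sub _ _ (fun x => (exists n, mark K n = x) \/ In x (snd K :: nil))).
  - intros x [n [h|h]]; [left; eauto|right; now left].
  - apply countable_union; [apply countable_range|apply countable_In]. }
intros x y px xy yq.
destruct (dense xy) as [x1 [xx1 x1y]]; destruct (dense x1y) as [y1 [x1y1 y1y]].
apply NNPP; intros miss.
assert (node_sub : forall K, node K -> meets K (p, q) -> across K).
{ intros K nK m; split; [trivial|split; [trivial|]].
  apply NNPP; intros h; apply none; exists K; split; trivial; split; order; tauto. }
apply none; exists (x1, y1); split; [|simpl; split; order].
apply nodeP; split; [split; [trivial|simpl; split; order]|].
intros K _ nK; pose proof (node_lt nK) as lK.
destruct (classic (meets K (x1, y1))) as [[m1 m2]|]; [right|now left]; simpl in *.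
assert (aK : across K) by (apply node_sub; trivial; split; simpl; order).
assert (out : forall z n, mark K n = z \/ snd K = z -> ~ (lt x z /\ lt z y)).
{ intros z n Hz [h1 h2]; apply miss; exists z; split; [eauto|tauto]. }
split; [|split]; simpl.
- pose proof (out (fst K) 0 (or_introl eq_refl)) as h.
  apply NNPP; intros h'; apply h; split; order.
- pose proof (out (snd K) 0 (or_intror eq_refl)) as h.
  apply NNPP; intros h'; apply h; split; order.
- intros i; pose proof (out (mark K i) i (or_introl eq_refl)) as h.
  apply NNPP; intros h'; apply not_or_and in h'; apply h; split; order.
Qed.

Let N := {K | node K}.
Let nle (K J : N) : Prop := K = J \/ inside (proj1_sig K) (proj1_sig J).
Let npart (K : N) (i : nat) (J : N) : Prop :=
  inside (proj1_sig K) (proj1_sig J) /\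
  ~ lt (fst (proj1_sig J)) (mark (proj1_sig K) i) /\
  ~ lt (mark (proj1_sig K) (S i)) (snd (proj1_sig J)).

Lemma node_eq (K J : N) : proj1_sig K = proj1_sig J -> K = J.
Proof.
destruct K as [K nK], J as [J nJ]; simpl; intros ->; f_equal; apply proof_irrelevance.
Qed.

Lemma N_lt (K : N) : lt (fst (proj1_sig K)) (snd (proj1_sig K)).
Proof. apply node_lt, proj2_sig. Qed.

Lemma nle_trans K J M : nle K J -> nle J M -> nle K M.
Proof.
intros [->|h1] [->|h2]; try (now left); right; trivial.
eapply inside_trans; eauto; apply N_lt.
Qed.

Lemma nle_ends K J : nle K J ->
  ~ lt (fst (proj1_sig J)) (fst (proj1_sig K)) /\ ~ lt (snd (proj1_sig K)) (snd (proj1_sig J)).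
Proof. intros [->|[h1 [h2 _]]]; split; order. Qed.

Lemma nle_cmp K J : meets (proj1_sig K) (proj1_sig J) -> nle K J \/ nle J K.
Proof.
intros m; destruct (node_cmp (proj2_sig K) (proj2_sig J) m) as [h|[h|h]].
- left; left; now apply node_eq.
- left; right; apply h.
- right; right; apply h.
Qed.

Lemma nle_tree K J M : nle K M -> nle J M -> nle K J \/ nle J K.
Proof.
intros KM JM; apply nle_cmp.
apply nle_ends in KM; apply nle_ends in JM; pose proof (N_lt M); split; order.
Qed.

Lemma nle_countable (A : N -> Prop) (B : L * L -> Prop) :
  (forall K, A K -> B (proj1_sig K)) -> countable_subset B -> countable_subset A.
Proof. apply countable_inj, node_eq. Qed.

Lemma node_fan_tree : fan_tree nle npart.
Proof.
split.
- now left.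
- apply nle_trans.
- intros K J [h|[h1 [h2 _]]] [h'|[h3 [h4 _]]]; auto; order.
- intros r s x; apply nle_tree.
- intros P [K0 PK0].
  destruct (@well_founded_min _ R (fun K => exists h, P (exist _ K h)) wfR)
    as [K [[nK PK] HK]].
  { destruct K0 as [K0 nK0]; eauto. }
  exists (exist _ K nK); split; trivial; intros [J nJ] PJ [h|h]; trivial.
  elim (HK J); [eauto|now apply inside_R].
- intros s i x h; right; apply h.
- intros s i [[h _] _]; order.
- intros s i x y [h1 [h2 h3]] xy; pose proof (nle_ends xy) as [h4 h5].
  split; [|split; order].
  destruct xy as [<-|xy]; trivial; eapply inside_trans; eauto; apply N_lt.
- assert (aux : forall s i j x, npart s i x -> npart s j x -> ~ i < j).
  { intros s i j x [_ [_ h1]] [_ [h2 _]] ij.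
    pose proof (@mark_le _ (S i) j (N_lt s) ij); pose proof (N_lt x); order. }
  intros s i j x h1 h2; pose proof (aux _ _ _ _ h1 h2); pose proof (aux _ _ _ _ h2 h1); lia.
- intros s r i x [->|sr] ne rx [_ [h1 h2]]; [tauto|].
  split; trivial; pose proof (nle_ends rx) as [h3 h4]; pose proof (N_lt x).
  destruct sr as [_ [_ sr]].
  split; [destruct (sr i)|destruct (sr (S i))]; order.
- intros s i; pose proof (N_lt s) as sl.
  assert (sa : admissible (proj1_sig s)) by (apply nodeP, proj2_sig).
  destruct sa as [_ [h1 h2]].
  pose proof (@mark_le _ 0 i sl (le_0_n i)) as h3; simpl in h3.
  pose proof (mark_S _ i sl) as h4; pose proof (mark_lt_snd _ (S i) sl) as h5.
  destruct (@node_dense (mark (proj1_sig s) i) (mark (proj1_sig s) (S i)))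
    as [J [nJ [h6 h7]]]; [order|order|order|].
  exists (exist _ J nJ); split; simpl fst; simpl snd; [|split; order].
  split; [order|split; [order|]]; intros j.
  destruct (le_lt_dec j i) as [ji|ij].
  + pose proof (mark_le _ sl ji); left; order.
  + pose proof (@mark_le _ (S i) j sl ij); right; order.
- intros A anti.
  apply (@ccc_on _ A (fun K => fst (proj1_sig K)) (fun K => snd (proj1_sig K))).
  + intros K _; apply N_lt.
  + intros K J AK AJ ne; apply NNPP; intros h; apply not_or_and in h.
    destruct (@nle_cmp K J) as [h'|h']; [split; order|apply ne; auto|].
    apply ne; symmetry; auto.
- intros x; apply (@nle_countable _ (fun K => exists h, nle (exist _ K h) x)).
  { intros [K nK] h; now exists nK. }
  apply countable_chain; [now intros K []|].
  intros J K [nJ hJ] [nK hK]; apply nle_ends in hJ; apply nle_ends in hK.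
  simpl in *; pose proof (N_lt x); split; order.
- intros cN.
  apply (@nosep u v); trivial; try apply lt_irr.
  exists (fun z => exists K : N, True /\ fst (proj1_sig K) = z); split.
  { apply countable_bigcup; trivial; intros K _; exists (fun _ => 0); congruence. }
  intros x y ux xy yv; destruct (node_dense ux xy yv) as [J [nJ [h1 h2]]].
  exists (fst J); split; [now exists (exist _ J nJ)|].
  pose proof (node_lt nJ); split; order.
Qed.

End Line.

Lemma souslin_fan_tree (L : Type) (lt : L -> L -> Prop) : souslin_line lt ->
  exists (T : Type) (le : T -> T -> Prop) (part : T -> nat -> T -> Prop), fan_tree le part.
Proof.
intros [slo [_ [dense [nsep ccc]]]].
destruct (nowhere_separable_interval slo ccc nsep) as [u [v [uv nosep]]].
destruct (well_ordering (L * L)) as [R [wf tot]].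
destruct (greedy_selection (admissible lt u v)
  (fun K J => ~ meets lt K J \/ inside lt K J) wf) as [node Hnode].
do 3 eexists; exact (node_fan_tree slo dense ccc uv nosep wf tot node Hnode).
Qed.

Theorem theorem3p2 :
  (exists (L : Type) (lt : L -> L -> Prop), souslin_line lt) ->
  exists (X Y : Type) (oX : (X -> Prop) -> Prop) (oY : (Y -> Prop) -> Prop),
    is_topology oX /\ infinite_type X /\ T1 oX /\
    is_topology oY /\ infinite_type Y /\ T1 oY /\
    rothberger oX /\ rothberger oY /\
    ~ weakly_lindelof (prod_open oX oY).
Proof.
intros [L [lt sl]].
destruct (souslin_fan_tree sl) as [T [le [part ft]]].
exists T, T, (fan_open part Nat.Even), (fan_open part Nat.Odd).
repeat split; try apply fan_topology; try apply (fan_infinite ft); try apply (fan_T1 ft).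
- apply (fan_rothberger ft); intros n; exists (2 * n); split; [lia|now exists n].
- apply (fan_rothberger ft); intros n; exists (2 * n + 1); split; [lia|now exists n].
- apply (fan_prod_not_weakly_lindelof ft); intros i [k Hk] [m Hm]; lia.
Qed.
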